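(* Let $k\ge 2$ and $1\le r\le k-1$. The generating function $\sum_\pi x^{|\pi|}$, where the sum is over all $123$-avoiding permutations $\pi$ with exactly $r$ occurrences of the pattern $(k-1)(k-2)\dots1k$, is given by $$x^{(r-1)/2}\frac{\left(U_{k-1}\left(\frac1{2\sqrt x}\right)\right)^{r-1}}{\left(U_k\left(\frac1{2\sqrt x}\right)\right)^{r+1}}.$$
   Context: For a permutation $\pi=\pi_1\cdots\pi_n$ of $\{1,\dots,n\}$ and a permutation $\sigma=\sigma_1\cdots\sigma_m$ of $\{1,\dots,m\}$, an occurrence of the pattern $\sigma$ in $\pi$ is a choice of indices $i_1<\dots<i_m$ such that $\pi_{i_1}\cdots\pi_{i_m}$ is in the same relative order as $\sigma$; $\pi$ is $\sigma$-avoiding if there is no occurrence. The pattern $(k-1)(k-2)\dots1k$ is the permutation of $\{1,\dots,k\}$ whose first $k-1$ entries are $k-1,\dots,1$ and whose last entry is $k$. $|\pi|$ denotes the number of elements permuted by $\pi$. $U_n$ denotes the $n$-th Chebyshev polynomial of the second kind, $U_n(\cos t)=\sin((n+1)t)/\sin t$. *)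

(* Defs.v *)
From HB Require Import structures.
From mathcomp Require Import all_boot all_order all_fingroup all_algebra.
From mathcomp Require Import all_classical all_reals all_analysis.
From mathcomp Require Import ring.

Set Implicit Arguments.
Unset Strict Implicit.
Unset Printing Implicit Defensive.

Import Order.TTheory GRing.Theory Num.Theory.

Local Open Scope ring_scope.

(** * Pattern occurrences *)

(* Indices and values are numbered from 0: [p] is the word (p 0)(p 1)...(p n.-1).
   An occurrence i_1 < ... < i_m is encoded as the map a |-> i_a. *)
Definition occurrences (m n : nat) (s : 'S_m) (p : 'S_n) :
    {set {ffun 'I_m -> 'I_n}} :=
  [set f : {ffun 'I_m -> 'I_n} |
     [forall a : 'I_m, forall b : 'I_m, (a < b)%N ==> (f a < f b)%N] &&
     [forall a : 'I_m, forall b : 'I_m,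
        (p (f a) < p (f b))%N == (s a < s b)%N]].

Definition avoids (m n : nat) (s : 'S_m) (p : 'S_n) : bool :=
  occurrences s p == finset.set0.

Definition pattern123 : 'S_3 := 1%g.

(* The pattern m (m-1) ... 1 (m+1). *)
Definition decr_max (m : nat) : 'S_m.+1 :=
  lift_perm ord_max ord_max (perm (@rev_ord_inj m)).

Lemma decr_maxE (m : nat) (i : 'I_m.+1) :
  decr_max m i = (if i == m :> nat then m else m - i.+1)%N :> nat.
Proof.
rewrite /decr_max; case: (unliftP ord_max i) => [j ->|->]; last first.
  by rewrite lift_perm_id eqxx.
by rewrite lift_perm_lift permE !lift_max /= (ltn_eqF (ltn_ord j)).
Qed.

(** * Formal power series *)

Record fps (K : Type) := Fps { fcoef : nat -> K }.

HB.instance Definition _ (K : Type) := gen_eqMixin (fps K).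
HB.instance Definition _ (K : Type) := gen_choiceMixin (fps K).

Lemma fpsP (K : Type) (f g : fps K) : (forall n, fcoef f n = fcoef g n) <-> f = g.
Proof.
split=> [|-> //]; case: f g => [f] [g] /= fg; congr Fps; exact/funext.
Qed.

Section FpsZmodule.
Variable K : zmodType.
Implicit Types f g h : fps K.

Definition fps_zero : fps K := Fps (fun=> 0).
Definition fps_opp f : fps K := Fps (fun n => - fcoef f n).
Definition fps_add f g : fps K := Fps (fun n => fcoef f n + fcoef g n).

Fact fps_addA : associative fps_add.
Proof. by move=> f g h; apply/fpsP => n /=; rewrite addrA. Qed.
Fact fps_addC : commutative fps_add.
Proof. by move=> f g; apply/fpsP => n /=; rewrite addrC. Qed.
Fact fps_add0 : left_id fps_zero fps_add.
Proof. by move=> f; apply/fpsP => n /=; rewrite add0r. Qed.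
Fact fps_addN : left_inverse fps_zero fps_opp fps_add.
Proof. by move=> f; apply/fpsP => n /=; rewrite addNr. Qed.

HB.instance Definition _ :=
  GRing.isZmodule.Build (fps K) fps_addA fps_addC fps_add0 fps_addN.

Lemma fcoef0 n : fcoef (0 : fps K) n = 0. Proof. by []. Qed.
Lemma fcoefD f g n : fcoef (f + g) n = fcoef f n + fcoef g n. Proof. by []. Qed.
Lemma fcoefN f n : fcoef (- f) n = - fcoef f n. Proof. by []. Qed.

End FpsZmodule.

Section FpsRing.
Variable K : idomainType.
Implicit Types f g h : fps K.

Definition fpsC (c : K) : fps K := Fps (fun n => if n == 0%N then c else 0).
Definition fpsX : fps K := Fps (fun n => (n == 1%N)%:R).
Definition fps_mul f g : fps K :=
  Fps (fun n => \sum_(i < n.+1) fcoef f i * fcoef g (n - i)%N).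

Let trunc (N : nat) f : {poly K} := \poly_(i < N) fcoef f i.

Let coef_trunc N f i : (i < N)%N -> (trunc N f)`_i = fcoef f i.
Proof. by move=> iN; rewrite coef_poly iN. Qed.

Let coef_trunc_mul N f g n : (n < N)%N ->
  fcoef (fps_mul f g) n = (trunc N f * trunc N g)`_n.
Proof.
move=> nN; rewrite coefM /=; apply: eq_bigr => i _.
have iN : (i < N)%N by apply: leq_trans nN.
have niN : (n - i < N)%N by apply: leq_ltn_trans nN; exact: leq_subr.
by rewrite !coef_trunc.
Qed.

Fact fps_mulC : commutative fps_mul.
Proof.
by move=> f g; apply/fpsP => n; rewrite !(coef_trunc_mul _ _ (ltnSn n)) mulrC.
Qed.

Fact fps_mulA : associative fps_mul.
Proof.
move=> f g h; apply/fpsP => n; rewrite !(coef_trunc_mul _ _ (ltnSn n)).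
transitivity ((trunc n.+1 f * (trunc n.+1 g * trunc n.+1 h))`_n).
  rewrite [LHS]coefM [RHS]coefM; apply: eq_bigr => i _; congr (_ * _).
  have lt : (n - i < n.+1)%N by rewrite ltnS leq_subr.
  by rewrite coef_trunc// (coef_trunc_mul _ _ lt).
rewrite mulrA [LHS]coefM [RHS]coefM; apply: eq_bigr => i _; congr (_ * _).
by rewrite coef_trunc// (coef_trunc_mul _ _ (ltn_ord i)).
Qed.

Fact fps_mul1 : left_id (fpsC 1) fps_mul.
Proof.
move=> f; apply/fpsP => n /=; rewrite big_ord_recl /= mul1r subn0.
by rewrite big1 ?addr0// => i _; rewrite mul0r.
Qed.

Fact fps_mulDl : left_distributive fps_mul +%R.
Proof.
move=> f g h; apply/fpsP => n /=; rewrite -big_split /=.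
by apply: eq_bigr => i _; rewrite mulrDl.
Qed.

Fact fps_oner_neq0 : fpsC 1 != 0.
Proof.
apply/eqP => /fpsP/(_ 0%N) /= /eqP; apply/negP; exact: oner_neq0.
Qed.

HB.instance Definition _ := GRing.Zmodule_isComNzRing.Build (fps K)
  fps_mulA fps_mulC fps_mul1 fps_mulDl fps_oner_neq0.

Lemma fcoefM f g n :
  fcoef (f * g) n = \sum_(i < n.+1) fcoef f i * fcoef g (n - i)%N.
Proof. by []. Qed.

Fact fpsC_is_zmod_morphism : zmod_morphism fpsC.
Proof. by move=> c d; apply/fpsP => -[|n] //=; rewrite subrr. Qed.

Fact fpsC_is_monoid_morphism : monoid_morphism fpsC.
Proof.
split=> // c d; apply/fpsP => n; rewrite fcoefM big_ord_recl /= subn0.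
rewrite big1 ?addr0 => [|i _]; last by rewrite mul0r.
by case: n => //= n; rewrite mulr0.
Qed.

HB.instance Definition _ :=
  GRing.isZmodMorphism.Build K (fps K) fpsC fpsC_is_zmod_morphism.
HB.instance Definition _ :=
  GRing.isMonoidMorphism.Build K (fps K) fpsC fpsC_is_monoid_morphism.

Definition fps_unit : pred (fps K) := fun f => `[< exists g, g * f = 1 >].
Definition fps_inv f : fps K :=
  if pselect (exists g, g * f = 1) is left ex then projT1 (cid ex) else f.

Fact fps_mulVf : {in fps_unit, left_inverse 1 fps_inv *%R}.
Proof.
move=> f /asboolP fU; rewrite /fps_inv.
by case: pselect => // ex; case: cid.
Qed.

Fact fps_unitPl f g : g * f = 1 -> fps_unit f.
Proof. by move=> gf; apply/asboolP; exists g. Qed.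

Fact fps_inv_out : {in [predC fps_unit], fps_inv =1 id}.
Proof.
move=> f /negP fU; rewrite /fps_inv; case: pselect => // ex.
by case: fU; apply/asboolP.
Qed.

HB.instance Definition _ := GRing.ComNzRing_hasMulInverse.Build (fps K)
  fps_mulVf fps_unitPl fps_inv_out.

Fact fps_lowest f : f != 0 ->
  exists n, fcoef f n != 0 /\ forall i, (i < n)%N -> fcoef f i = 0.
Proof.
move=> f0; have ex : exists n, fcoef f n != 0.
  apply: contrapT => nex; move/eqP: f0; apply; apply/fpsP => n.
  by apply/eqP; apply: contrapT => /negP fn; apply: nex; exists n.
case: (ex_minnP ex) => n fn min; exists n; split=> // i lt.
apply/eqP; apply: contraTT lt => fi; by rewrite -leqNgt min.
Qed.

Fact fps_idomain f g : f * g = 0 -> (f == 0) || (g == 0).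
Proof.
move=> fg0; case: (eqVneq f 0) => //= f0; apply: contraT => g0.
have [m [fm mf]] := fps_lowest f0; have [n [gn ng]] := fps_lowest g0.
have := congr1 (fun h => fcoef h (m + n)%N) fg0; rewrite fcoefM fcoef0.
have mmn : (m < (m + n).+1)%N by rewrite ltnS leq_addr.
rewrite (bigD1 (Ordinal mmn)) //= big1 => [|i im].
  by rewrite addr0 addKn => /eqP; rewrite mulf_eq0 (negPf fm) (negPf gn).
have : nat_of_ord i != m by [].
rewrite neq_ltn => /orP[lt|gt]; first by rewrite (mf _ lt) mul0r.
rewrite (ng (m + n - i)%N) ?mulr0//.
by rewrite ltn_subLR ?ltn_add2r// -ltnS ltn_ord.
Qed.

HB.instance Definition _ :=
  GRing.ComUnitRing_isIntegral.Build (fps K) fps_idomain.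

End FpsRing.

Arguments fpsX {K}.

(* [f(X)] maps to [f(X^2)]: when [X] stands for sqrt x, this views a power series
   in x as a power series in sqrt x. *)
Definition fps_compX2 (K : zmodType) (f : fps K) : fps K :=
  Fps (fun n => if odd n then 0 else fcoef f n./2).

(* The sum of x^|p| over all the permutations [p] (of any size) satisfying [A]. *)
Definition perm_gf (K : idomainType) (A : forall n, pred 'S_n) : fps K :=
  Fps (fun n => #|[set p : 'S_n | A n p]|%:R).

Definition laurent (K : fieldType) := {fraction fps K}.

Notation "f %:F" := (@FracField.tofrac _ f : laurent _) : ring_scope.

Definition laurentC (K : fieldType) (c : K) : laurent K := (fpsC c)%:F.

HB.instance Definition _ (K : fieldType) := GRing.RMorphism.copy (@laurentC K)
  (@FracField.tofrac (fps K) \o @fpsC K).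

(** * Chebyshev polynomials of the second kind *)

Definition is_chebyshevU (R : realType) (n : nat) (U : {poly R}) : Prop :=
  forall t : R, sin t != 0 -> U.[cos t] = sin (n.+1%:R * t) / sin t.

Lemma is_chebyshevU_ex (R : realType) (n : nat) :
  exists U : {poly R}, is_chebyshevU n U.
Proof.
suff [U [V [HU _]]] : exists U V : {poly R},
  is_chebyshevU n U /\ is_chebyshevU n.+1 V by exists U.
elim: n => [|n [U [V [HU HV]]]].
  exists 1, (2%:R *: 'X); split=> t t0; first by rewrite hornerC mul1r divff.
  by rewrite hornerZ hornerX mulr_natl mulr_natl sin_mulr2n mulrnAl mulfK.
exists V, (2%:R *: 'X * V - U); split=> // t t0.
rewrite !hornerE HV// HU//; apply: (mulIf t0).
rewrite mulrBl mulrA !divfK//.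
have -> : n.+3%:R * t = n.+2%:R * t + t by rewrite -[n.+3]addn1 natrD mulrDl mul1r.
have -> : n.+1%:R * t = n.+2%:R * t - t.
  by rewrite -[n.+2]addn1 natrD mulrDl mul1r addrK.
by rewrite sinB sinD; ring.
Qed.

Lemma is_chebyshevU_unique (R : realType) (n : nat) (U V : {poly R}) :
  is_chebyshevU n U -> is_chebyshevU n V -> U = V.
Proof.
move=> HU HV; apply/eqP; rewrite -subr_eq0; apply: contraT => UV0.
have bnd (i : nat) : 0 < (i.+1%:R^-1 : R) < pi.
  rewrite invr_gt0 ltr0n /= (@le_lt_trans _ _ 1)//.
    by rewrite invf_le1 ?ltr0n// ler1n.
  by rewrite (lt_le_trans _ (pi_ge2 R))// ltr1n.
pose s := [seq cos (i.+1%:R^-1 : R) | i <- iota 0 (size (U - V))].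
have : (size s < size (U - V)%R)%N; last by rewrite size_map size_iota ltnn.
apply: max_poly_roots => //.
  apply/allP => _ /mapP[i _ ->]; rewrite rootE !hornerE.
  have s0 : sin (i.+1%:R^-1 : R) != 0 by rewrite gt_eqF ?sin_gt0_pi.
  by rewrite HU// HV// subrr.
rewrite map_inj_uniq ?iota_uniq// => i j /cos_inj.
have mem (l : nat) : (l.+1%:R^-1 : R) \in `[0, pi].
  by rewrite in_itv /=; have /andP[/ltW -> /ltW ->] := bnd l.
by move=> /(_ (mem i) (mem j))/invr_inj/eqP; rewrite eqr_nat => /eqP[].
Qed.

(* Main.v *)
(* The smaller entries to the left of an entry of a 123-avoiding permutation are
   decreasing, so an entry with a smaller ones to its left is the last entry of
   'C(a, k - 1) occurrences. Building 123-avoiding permutations by appending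
   entries, all that matters is the number h + 1 of values that can be appended:
   the value 0 changes h into h + 1, a value 1 <= v <= h changes h into v and
   creates 'C(v, k - 1) occurrences. As r <= k - 1 excludes v >= k, all states
   h >= k - 1 are equivalent, and the generating functions of the remaining k
   states satisfy the three-term recurrence of the Chebyshev polynomials. *)
Require Import Defs.
From mathcomp Require Import all_boot all_order all_fingroup all_algebra.
From mathcomp Require Import all_classical all_reals all_analysis.
From mathcomp Require Import zify ring.

Set Implicit Arguments.
Unset Strict Implicit.
Unset Printing Implicit Defensive.

Import Order.TTheory GRing.Theory Num.Theory.
Local Open Scope ring_scope.

(** * Appending a last entry to a 123-avoiding permutation *)

Lemma avoids123P n (p : 'S_n) :
  reflect (forall i j l : 'I_n, (i < j < l)%N -> ~~ (p i < p j < p l)%N)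
          (avoids pattern123 p).
Proof.
apply: (iffP eqP) => [p0 i j l /andP[ij jl]|pP].
  apply/negP => /andP[pij pjl].
  pose f := [ffun a : 'I_3 => nth i [:: i; j; l] a].
  have : f \in occurrences pattern123 p; last by rewrite p0 inE.
  rewrite inE; apply/andP; split; apply/forallP => a; apply/forallP => b.
    by rewrite !ffunE; case: a b => -[|[|[|//]]] ? [] -[|[|[|//]]] ? //=; lia.
  rewrite !ffunE !perm1.
  by case: a b => -[|[|[|//]]] ? [] -[|[|[|//]]] ? //=; lia.
apply/finset.setP => f; rewrite !inE; apply/negP => /andP[incf /forallP fP].
have fo (a b : 'I_3) : (a < b)%N -> (f a < f b)%N && (p (f a) < p (f b))%N.
  move=> ab; have := forallP (forallP incf a) b; rewrite ab /= => ->.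
  by have /forallP/(_ b)/eqP -> := fP a; rewrite !perm1.
pose o (i : nat) : 'I_3 := inord i.
have /andP[f01 p01] := fo (o 0%N) (o 1%N) ltac:(by rewrite !inordK).
have /andP[f12 p12] := fo (o 1%N) (o 2%N) ltac:(by rewrite !inordK).
by have := pP _ _ _ (introT andP (conj f01 f12)); rewrite p01 p12.
Qed.

(** The smaller predecessor need not be adjacent; such an entry becomes the 2 of a 123 once a larger
    value is appended. *)
Definition ascent_top n (p : 'S_n) (j : 'I_n) : bool :=
  [exists i : 'I_n, (i < j)%N && (p i < p j)%N].

(* The values that can be appended to [p] without creating an occurrence of 123
   are 0, ..., room p. *)
Definition room n (p : 'S_n) : nat :=
  \big[Order.min/n]_(j | ascent_top p j) (p j : nat).

Lemma leq_roomP n (p : 'S_n) v :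
  reflect ((v <= n)%N /\ forall j, ascent_top p j -> (v <= p j)%N)
          (v <= room p)%N.
Proof. by rewrite -leEnat; apply: bigmin_geP. Qed.

Lemma ltn_lift n (h : 'I_n.+1) (i j : 'I_n) :
  (lift h i < lift h j)%N = (i < j)%N.
Proof. by rewrite /= /bump; lia. Qed.

Lemma ltn_lift_max n (i : 'I_n) : (lift ord_max i < @ord_max n)%N.
Proof. by rewrite lift_max. Qed.

Section Append.
Variables (n : nat) (p : 'S_n) (v : 'I_n.+1).
Let q : 'S_n.+1 := lift_perm ord_max v p.

Let q_max : q ord_max = v. Proof. exact: lift_perm_id. Qed.
Let q_lift i : q (lift ord_max i) = lift v (p i).
Proof. exact: lift_perm_lift. Qed.

Lemma ascent_top_append_lift j :
  ascent_top q (lift ord_max j) = ascent_top p j.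
Proof.
apply/existsP/existsP => -[i]; last first.
  by move=> ij; exists (lift ord_max i); rewrite !q_lift !ltn_lift.
case: (unliftP ord_max i) => [i' ->|->].
  by rewrite !q_lift !ltn_lift => ij; exists i'.
by rewrite lift_max /= ltnNge ltnW.
Qed.

Lemma ascent_top_append_max : ascent_top q ord_max = (0 < v)%N.
Proof.
apply/existsP/idP => [[i /andP[_]]|v0].
  by rewrite q_max; apply: leq_ltn_trans.
exists (q^-1 ord0)%g; rewrite permKV q_max v0 andbT.
rewrite ltn_neqAle -ltnS ltn_ord andbT; apply/negP => /eqP/val_inj e.
by move: v0; rewrite -q_max -e permKV.
Qed.

(** A 123 that uses the new entry must end there, so its first two entries form an ascent of [p].
    After [lift v] the top of that ascent is below [v] exactly when it was before. *)
Lemma avoids_append :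
  avoids pattern123 q = avoids pattern123 p && (v <= room p)%N.
Proof.
apply/avoids123P/andP => [qP|[/avoids123P pP /leq_roomP[_ vP]] i j l].
  split.
    apply/avoids123P => i j l ijl.
    have := qP (lift ord_max i) (lift ord_max j) (lift ord_max l).
    by rewrite !q_lift !ltn_lift; apply.
  apply/leq_roomP; split=> [|j /existsP[i /andP[ij pij]]].
    by rewrite -ltnS.
  have := qP (lift ord_max i) (lift ord_max j) ord_max.
  rewrite !q_lift q_max !ltn_lift ltn_lift_max ij pij => /(_ isT).
  by rewrite /= /bump; lia.
case: (unliftP ord_max i) => [i' ->|->]; last by rewrite ltnNge -ltnS ltn_ord.
case: (unliftP ord_max j) => [j' ->|->]; last by rewrite andbC ltnNge -ltnS ltn_ord.
case: (unliftP ord_max l) => [l' ->|->].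
  by rewrite !q_lift !ltn_lift; apply: pP.
rewrite !q_lift q_max ltn_lift_max !ltn_lift andbT => ij.
apply/negP => /andP[pij].
have /vP : ascent_top p j' by apply/existsP; exists i'; rewrite ij.
by rewrite /= /bump; lia.
Qed.

(** Old ascent tops are at least [v], so each moves up by one. For [v] zero the new entry is no
    ascent top; otherwise it is the smallest one. *)
Lemma room_append : (v <= room p)%N ->
  room q = if v == 0%N :> nat then (room p).+1 else v.
Proof.
move=> vp; apply/eqP; rewrite eqn_leq; apply/andP; split.
  have /leq_roomP[rn rt] := leqnn (room q).
  case: eqP => [v0|/eqP v0]; last first.
    by have := rt ord_max; rewrite ascent_top_append_max q_max lt0n; apply.
  suff : ((room q).-1 <= room p)%N by lia.
  apply/leq_roomP; split=> [|j tj]; first by lia.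
  have := rt (lift ord_max j); rewrite ascent_top_append_lift q_lift /=.
  by rewrite /bump => /(_ tj); lia.
have /leq_roomP[rn rt] := leqnn (room p).
apply/leq_roomP; split=> [|j]; first by case: ifP => _; have := ltn_ord v; lia.
case: (unliftP ord_max j) => [j' ->|->].
  rewrite ascent_top_append_lift q_lift => /rt /=.
  by rewrite /bump; case: ifP; lia.
by rewrite ascent_top_append_max q_max; case: ifP; lia.
Qed.

End Append.

(** * Occurrences gained by appending a last entry *)

Lemma card_ltn_perm n (q : 'S_n) (v : nat) : (v <= n)%N ->
  #|[set i | (q i < v)%N]| = v.
Proof.
move=> vn.
rewrite -(card_imset _ (@perm_inj _ q)).
have -> : q @: [set i | (q i < v)%N] = [set i : 'I_n | (i < v)%N].
  apply/finset.setP => i; rewrite inE; apply/imsetP/idP => [[j]|iv].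
    by rewrite inE => ? ->.
  by exists (q^-1 i)%g; rewrite ?inE permKV.
by rewrite -sum1dep_card (big_ord_narrow vn) sum_nat_const card_ord muln1.
Qed.

Lemma decr_max_ltn m (a b : 'I_m.+1) :
  (decr_max m a < decr_max m b)%N =
  (a < m)%N && ((b == m :> nat) || (b < a)%N).
Proof.
rewrite !decr_maxE; have := ltn_ord a; have := ltn_ord b.
by do 2 case: eqP; lia.
Qed.

Lemma occurrencesP m n (s : 'S_m) (p : 'S_n) (f : {ffun 'I_m -> 'I_n}) :
  reflect ((forall a b : 'I_m, (a < b)%N -> (f a < f b)%N) /\
           forall a b, (p (f a) < p (f b))%N = (s a < s b)%N)
          (f \in occurrences s p).
Proof.
rewrite inE; apply: (iffP andP) => -[/= fP gP]; split.
- by move=> a b ab; have := forallP (forallP fP a) b; rewrite ab.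
- by move=> a b; have /forallP/(_ b)/eqP := forallP gP a.
- by apply/forallP => a; apply/forallP => b; apply/implyP; apply: fP.
- by apply/forallP => a; apply/forallP => b; apply/eqP; apply: gP.
Qed.

Lemma sorted_enum_ord n (A : {set 'I_n}) :
  sorted (fun i j : 'I_n => (i < j)%N) (enum A).
Proof.
rewrite /enum_mem -enumT; apply: sorted_filter.
  by move=> ? ? ?; apply: ltn_trans.
by have := iota_ltn_sorted 0 n; rewrite -val_enum_ord sorted_map.
Qed.

(* In a 123-avoiding permutation the entries smaller than the last one are
   decreasing, so any [m] of them form an occurrence together with the last entry. *)
Lemma card_occurrences_last m n (q : 'S_n.+1) : avoids pattern123 q ->
  #|occurrences (decr_max m) q
    :&: [set f : {ffun 'I_m.+1 -> 'I_n.+1} | f ord_max == ord_max]|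
  = 'C(q ord_max, m).
Proof.
move=> /avoids123P qP.
pose B := [set i | (q i < q ord_max)%N].
(* The default of [nth] supplies the last position as the index that follows the [m] elements of
   [A]. *)
pose g (A : {set 'I_n.+1}) := [ffun a : 'I_m.+1 => nth (@ord_max n) (enum A) a].
have lt_max i : i \in B -> (i < @ord_max n)%N.
  rewrite inE => qi; rewrite ltn_neqAle -ltnS ltn_ord andbT.
  by apply/negP => /eqP/val_inj e; move: qi; rewrite e ltnn.
have decrB i j : i \in B -> j \in B -> (i < j)%N -> (q j < q i)%N.
  move=> iB jB ij; have jm := lt_max _ jB.
  have := qP i j ord_max; rewrite ij jm => /(_ isT).
  move: (jB); rewrite inE => ->; rewrite andbT -leqNgt leq_eqVlt => /orP[|//].
  by move=> /eqP/val_inj/perm_inj e; rewrite e ltnn in ij.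
have -> : 'C(q ord_max, m) = #|[set A : {set 'I_n.+1} | A \subset B & #|A| == m]|.
  by rewrite cards_draws card_ltn_perm// ltnW.
rewrite -(@card_in_imset _ _ g); last first.
  move=> A A'; rewrite !inE => /andP[_ /eqP Am] /andP[_ /eqP A'm] /ffunP e.
  have eA : enum A = enum A'.
    apply: (@eq_from_nth _ ord_max); first by rewrite -!cardE Am.
    move=> i; rewrite -cardE Am => im; have im1 : (i < m.+1)%N by rewrite ltnW.
    by have := e (Ordinal im1); rewrite !ffunE.
  by apply/finset.setP => x; rewrite -mem_enum eA mem_enum.
apply: eq_card; move=> f; rewrite inE; apply/andP/imsetP.
  move=> [/occurrencesP[fi fo]]; rewrite inE => /eqP fm.
  pose h (a : 'I_m) := f (lift ord_max a).
  have hi (a b : 'I_m) : (a < b)%N -> (h a < h b)%N.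
    by move=> ab; apply: fi; rewrite ltn_lift.
  have h_inj : injective h.
    move=> a b e; apply/val_inj.
    by case: (ltngtP a b) => // /hi; rewrite e ltnn.
  exists (h @: [set: 'I_m]).
    rewrite inE card_imset// cardsT card_ord eqxx andbT.
    apply/fintype.subsetP => _ /imsetP[a _ ->].
    by rewrite inE -fm fo decr_max_ltn lift_max /= ltn_ord eqxx.
  have eh : enum (h @: [set: 'I_m]) = map h (enum 'I_m).
    apply: (@irr_sorted_eq _ (fun i j : 'I_n.+1 => (i < j)%N)).
    - by move=> ? ? ?; apply: ltn_trans.
    - by move=> ?; apply: ltnn.
    - exact: sorted_enum_ord.
    - rewrite sorted_map; apply: (@sub_sorted _ (fun i j : 'I_m => (i < j)%N)).
        by move=> a b; apply: hi.
      by have := iota_ltn_sorted 0 m; rewrite -val_enum_ord sorted_map.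
    move=> i; rewrite mem_enum; apply/imsetP/mapP => -[a _ ->]; exists a => //.
    by rewrite mem_enum.
  apply/ffunP => a; rewrite ffunE eh.
  case: (unliftP ord_max a) => [a' ->|->].
    by rewrite lift_max (nth_map a') ?size_enum_ord// nth_ord_enum.
  by rewrite nth_default ?fm// size_map size_enum_ord.
move=> [A]; rewrite inE => /andP[/fintype.subsetP AB /eqP Am] ->.
have gB (a : 'I_m.+1) : (a < m)%N -> g A a \in B.
  by move=> am; rewrite ffunE; apply/AB; rewrite -mem_enum mem_nth// -cardE Am.
have gm (a : 'I_m.+1) : a = m :> nat -> g A a = ord_max.
  by move=> am; rewrite ffunE nth_default// -cardE Am am.
have gi (a b : 'I_m.+1) : (b < m)%N -> (a < b)%N -> (g A a < g A b)%N.
  move=> bm ab; rewrite !ffunE.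
  apply: (sorted_ltn_nth _ _ (sorted_enum_ord A)) => //.
  - by move=> ? ? ?; apply: ltn_trans.
  - by rewrite inE -cardE Am (ltn_trans ab).
  - by rewrite inE -cardE Am.
have le_m (a : 'I_m.+1) : (a < m)%N \/ a = m :> nat.
  by have := ltn_ord a; rewrite ltnS leq_eqVlt => /orP[/eqP|]; tauto.
split; last by rewrite inE gm.
apply/occurrencesP; split=> a b.
  case: (le_m b) => [|bm ab]; first exact: gi.
  by rewrite (gm b)// lt_max// gB//; apply: leq_trans ab _; rewrite bm.
rewrite decr_max_ltn; case: (le_m a) => [am|am]; last first.
  rewrite am ltnn (gm a)//=; case: (le_m b) => [/gB|/gm ->]; last by rewrite ltnn.
  by rewrite inE => /ltnW; rewrite leqNgt => /negPf.
rewrite am; case: (le_m b) => [bm|bm]; last first.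
  by rewrite bm eqxx (gm b)//; have := gB _ am; rewrite inE.
rewrite (ltn_eqF bm) /=.
case: (ltngtP a b) => [ab|ba|/val_inj ->]; last by rewrite ltnn.
  by apply/negbTE; rewrite -leqNgt ltnW// decrB ?gB ?gi.
by rewrite decrB ?gB ?gi.
Qed.

(** The last index of an occurrence is its largest, so if it is not [ord_max] the whole occurrence
    lies in [p]. *)
Lemma card_occurrences_not_last m n (p : 'S_n) (v : 'I_n.+1) :
  #|occurrences (decr_max m) (lift_perm ord_max v p)
    :\: [set f : {ffun 'I_m.+1 -> 'I_n.+1} | f ord_max == ord_max]|
  = #|occurrences (decr_max m) p|.
Proof.
pose g (f : {ffun 'I_m.+1 -> 'I_n}) := [ffun a => lift (@ord_max n) (f a)].
have g_inj : injective g.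
  move=> f f' /ffunP e; apply/ffunP => a.
  by have := e a; rewrite !ffunE => /lift_inj.
rewrite -(card_imset _ g_inj); apply: eq_card => f; rewrite finset.in_setD inE.
apply/andP/imsetP => [[fm /occurrencesP[fi fo]]|[f' /occurrencesP[fi fo] ->]].
  have fN a : exists b, f a == lift ord_max b.
    case: (unliftP ord_max (f a)) => [b ->|fa]; first by exists b.
    have := ltn_ord a; rewrite ltnS leq_eqVlt => /orP[/eqP am|am].
      by case/eqP: fm; rewrite -fa; congr (f _); apply/val_inj.
    by have := fi a ord_max am; rewrite fa ltnNge -ltnS ltn_ord.
  pose f' := [ffun a => xchoose (fN a)].
  have ff' a : f a = lift ord_max (f' a).
    by rewrite ffunE; apply/eqP; apply: (xchooseP (fN a)).
  exists f'; last by apply/ffunP => a; rewrite [RHS]ffunE.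
  apply/occurrencesP; split=> a b.
    by move=> /fi; rewrite !ff' ltn_lift.
  by rewrite -fo !ff' !lift_perm_lift ltn_lift.
split; first by rewrite ffunE; apply/eqP => /esym/eqP; apply/negP; apply: neq_lift.
apply/occurrencesP; split=> a b; rewrite !ffunE.
  by rewrite ltn_lift; apply: fi.
by rewrite !lift_perm_lift ltn_lift.
Qed.

Lemma card_occurrences_append m n (p : 'S_n) (v : 'I_n.+1) :
  avoids pattern123 (lift_perm ord_max v p) ->
  #|occurrences (decr_max m) (lift_perm ord_max v p)|
  = (#|occurrences (decr_max m) p| + 'C(v, m))%N.
Proof.
move=> qa.
rewrite -(cardsID [set f : {ffun 'I_m.+1 -> 'I_n.+1} | f ord_max == ord_max]).
rewrite addnC.
by rewrite card_occurrences_not_last card_occurrences_last// lift_perm_id.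
Qed.

(** * The transfer recursion *)

Lemma lift_perm_bij n :
  bijective (fun pv : 'S_n * 'I_n.+1 => lift_perm ord_max pv.2 pv.1).
Proof.
apply: inj_card_bij => [[p v] [p' v'] /= e|]; last first.
  by rewrite card_prod !card_Sn card_ord factS mulnC.
have ev : v = v'.
  by rewrite -(lift_perm_id ord_max v p) e lift_perm_id.
congr pair => //; apply/permP => i; apply: (@lift_inj _ v).
by rewrite -(lift_perm_lift ord_max) e lift_perm_lift ev.
Qed.

(* The number of ways to append [n] entries to a 123-avoiding permutation with
   room [h] and [c] occurrences of [decr_max m] so that the result avoids 123 and
   has exactly [r] occurrences. *)
Fixpoint continuations (m r n h c : nat) : nat :=
  if n is n'.+1 then
    (continuations m r n' h.+1 c
     + \sum_(v < h) continuations m r n' v.+1 (c + 'C(v.+1, m)))%N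
  else (c == r).

(** A permutation of size [n + 1] is one of size [n] with a value appended; summing over that value
    is one unfolding of [continuations]. *)
Lemma sum_continuations m r n l : (0 < m)%N ->
  (\sum_(p : 'S_(l + n) | avoids pattern123 p)
     (#|occurrences (decr_max m) p| == r)
  = \sum_(p : 'S_n | avoids pattern123 p)
     continuations m r l (room p) #|occurrences (decr_max m) p|)%N.
Proof.
move=> m0; elim: l n => [//|l IH] n.
rewrite addSnnS IH {IH} (reindex _ (onW_bij _ (lift_perm_bij n))) /=.
pose W h c := continuations m r l h c.
transitivity (\sum_(p : 'S_n | avoids pattern123 p)
    \sum_(v < n.+1 | (v < (room p).+1)%N)
       W (if v == 0%N :> nat then (room p).+1 else v)
         (#|occurrences (decr_max m) p| + 'C(v, m)))%N.
  rewrite pair_big_dep; apply: eq_big => [pv|pv]; rewrite avoids_append//.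
  move=> /andP[pa vr].
  by rewrite room_append// card_occurrences_append// avoids_append pa.
apply: eq_bigr => p _.
have /leq_roomP[rn _] := leqnn (room p).
(* The value 0 comes out of the sum: it raises the room and, as [m] is positive, creates no
   occurrence. *)
rewrite -(big_ord_widen n.+1 (fun v => W (if v == 0%N then (room p).+1 else v)
  (#|occurrences (decr_max m) p| + 'C(v, m))%N))// big_ord_recl /=.
by rewrite bin_small// addn0.
Qed.

(** Every permutation grows from the empty one, which has room 0 and no occurrence of a nonempty
    pattern. *)
Lemma card_avoids_occurrences m r n : (0 < m)%N ->
  #|[set p : 'S_n | avoids pattern123 p
                    && (#|occurrences (decr_max m) p| == r)]|
  = continuations m r n 0 0.
Proof.
move=> m0; have := sum_continuations r 0 n m0; rewrite addn0 => e.
rewrite -sum1dep_card big_mkcondr /=.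
transitivity (\sum_(p : 'S_n | avoids pattern123 p)
    (#|occurrences (decr_max m) p| == r))%N.
  by apply: eq_bigr => p _; case: eqP.
rewrite {}e.
rewrite (eq_bigl xpredT) => [|p]; last first.
  by apply/avoids123P => i; have := ltn_ord i.
rewrite (eq_bigr (fun=> continuations m r n 0 0)) => [|p _].
  by rewrite sum_nat_const card_Sn mul1n.
have /leq_roomP[] := leqnn (room p); rewrite leqn0 => /eqP -> _.
suff -> : occurrences (decr_max m) p = finset.set0 by rewrite cards0.
by apply/finset.setP => f; have := ltn_ord (f ord0).
Qed.

(** * Linear recurrences in the room *)

Section Recursion.
Variables m r : nat.
Hypotheses (m_gt0 : (0 < m)%N) (le_rm : (r <= m)%N).
Local Notation w := (continuations m r).

(** Appending entries never destroys an occurrence. *)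
Lemma continuations_gt n h c : (r < c)%N -> w n h c = 0%N.
Proof.
elim: n h c => [|n IH] h c rc /=; first by rewrite gtn_eqF.
rewrite IH// big1// => v _; apply: IH; exact: ltn_addr.
Qed.

(** Appending a value above [m] creates at least ['C(m.+1, m) = m.+1 > r] occurrences, so the values
    that distinguish these rooms contribute nothing. *)
Lemma continuations_geq n h c : (m <= h)%N -> w n h c = w n m c.
Proof.
elim: n h c => [//|n IH] h c mh /=.
rewrite (IH h.+1) ?(leq_trans mh)// (IH m.+1)//; congr addn.
rewrite (big_ord_widen _ (fun v => w n v.+1 (c + 'C(v.+1, m))) mh).
rewrite [RHS]big_mkcond; apply: eq_bigr => v _; case: ltnP => // mv.
apply: continuations_gt; rewrite (leq_trans _ (leq_addl _ _))//.
have : ('C(m.+1, m) <= 'C(v.+1, m))%N by apply: leq_bin2l.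
by rewrite binSn; lia.
Qed.

(** The sum for room [h + 1] has one extra term, for the value [h + 1]; it creates no occurrence and
    equals the leading term for room [h]. *)
Lemma continuations_below n h c : (h.+1 < m)%N ->
  w n.+1 h.+1 c = (w n.+1 h c + w n h.+2 c)%N.
Proof.
move=> hm /=; rewrite big_ord_recr /= bin_small// addn0.
by rewrite addnC [X in (X + _)%N = _]addnC.
Qed.

(** The same telescoping, except that the value [m] creates exactly one occurrence and room [m + 1]
    is equivalent to room [m]. *)
Lemma continuations_top n c :
  w n.+1 m c = (w n.+1 m.-1 c + w n m c.+1)%N.
Proof.
have := continuations_geq n c (leqnSn m).
case: m m_gt0 => // m' _ /= ->.
by rewrite big_ord_recr /= binn addn1 addnA.
Qed.

End Recursion.

(** * Solving the recursion *)

(* With [b n.+1 = s ^+ n * u n], every [G (m - i) c] is a combination of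
   [G m c] and [G m c.+1] with coefficients [b i.+1] and [- s ^+ 2 * b i]; the
   boundary condition at 0 then determines [G m c] for all [c <= r]. *)
Lemma transfer_solution (L : fieldType) (s : L) (u : nat -> L)
    (G : nat -> nat -> L) (m r : nat) :
  s != 0 -> u 0%N = 1 -> u 1%N = s^-1 ->
  (forall n, u n.+2 = u n.+1 / s - u n) ->
  (forall c, G m.+1 c = G m c + s ^+ 2 * G m.+1 c.+1) ->
  (forall h c, (h < m)%N -> G h.+1 c = G h c + s ^+ 2 * G h.+2 c) ->
  (forall c, G 0%N c = (c == r.+1)%:R + s ^+ 2 * G 1%N c) ->
  G m.+1 r.+2 = 0 ->
  G 0%N 0%N = s ^+ r * (u m.+1 ^+ r / u m.+2 ^+ r.+2).
Proof.
move=> s0 u0 u1 uS G_top G_below G_0 G_gt.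
(* Scaling by powers of [s] removes the division from the recurrence of [u]; the shift with
   [b 0 = 0] lets it start at 0. *)
have [b [b0 bE]] : exists b, b 0%N = 0 /\ forall n, b n.+1 = s ^+ n * u n.
  by exists (fun n => if n is n'.+1 then s ^+ n' * u n' else 0).
have b1 : b 1%N = 1 by rewrite bE u0 mulr1.
have bS n : b n.+2 = b n.+1 - s ^+ 2 * b n.
  case: n => [|n]; first by rewrite b0 !bE u0 u1 mulr0 subr0 expr1 divff ?mulr1.
  by rewrite !bE uS !exprS; field.
have cassini n : b n.+1 ^+ 2 - b n * b n.+2 = s ^+ n ^+ 2.
  elim: n => [|n IH]; first by rewrite b0 b1 mul0r subr0 expr1n.
  by rewrite [s ^+ n.+1]exprS exprMn -IH [b n.+3]bS bS; ring.
have G_down i c : (i <= m.+1)%N ->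
    G (m.+1 - i)%N c = b i.+1 * G m.+1 c - s ^+ 2 * b i * G m.+1 c.+1.
  (* The recurrence has order two, so the induction carries two consecutive indices. *)
  suff : ((i <= m.+1)%N -> G (m.+1 - i)%N c =
      b i.+1 * G m.+1 c - s ^+ 2 * b i * G m.+1 c.+1) /\
    ((i.+1 <= m.+1)%N -> G (m.+1 - i.+1)%N c =
      b i.+2 * G m.+1 c - s ^+ 2 * b i.+1 * G m.+1 c.+1) by case.
  elim: i => [|i [IH1 IH2]]; split=> //.
  - by rewrite subn0 b0 b1 !(mulr0, mul0r, subr0, mul1r).
  - move=> _; by rewrite subSS subn0 bS b0 b1 G_top; ring.
  move=> im; have := G_below (m.+1 - i.+2)%N c.
  have -> : (m.+1 - i.+2).+2 = (m.+1 - i)%N by lia.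
  have -> : (m.+1 - i.+2).+1 = (m.+1 - i.+1)%N by lia.
  rewrite IH1 ?IH2; [|by lia..] => /(_ ltac:(lia)).
  move=> /esym/(canRL (addrK _)) ->.
  by rewrite [b i.+3]bS [b i.+2]bS; ring.
(* If the recurrence is extended one step below state 0, the value there is 1 for [c = r + 1] and 0
   otherwise. *)
have boundary c :
    b m.+3 * G m.+1 c - s ^+ 2 * b m.+2 * G m.+1 c.+1 = (c == r.+1)%:R.
  have := G_0 c; have := G_down m.+1 c (leqnn _); rewrite subnn => ->.
  have := G_down m c (leqnSn _); rewrite subSnn => ->.
  move=> /esym/(canRL (addrK _)) ->.
  by rewrite [b m.+3]bS [b m.+2]bS; ring.
(* Otherwise the boundary equation at [c = r + 1] would read 0 = 1. *)
have B0 : b m.+3 != 0.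
  apply: contra_eq_neq (boundary r.+1) => ->.
  by rewrite G_gt mulr0 mul0r subr0 eqxx eq_sym oner_eq0.
(* Solve downwards from [c = r + 1], dividing by [b m.+3] each time. *)
have G_m j : (j <= r.+1)%N ->
    G m.+1 (r.+1 - j)%N = (s ^+ 2 * b m.+2) ^+ j / b m.+3 ^+ j.+1.
  elim: j => [_|j IH jr].
    rewrite subn0 expr0 expr1; have := boundary r.+1.
    by rewrite G_gt eqxx mulr0 subr0 => e; apply: (mulfI B0); rewrite e mul1r mulfV.
  have := boundary (r.+1 - j.+1)%N.
  have -> : (r.+1 - j.+1).+1 = (r.+1 - j)%N by lia.
  have -> : (r.+1 - j.+1 == r.+1)%N = false by apply/eqP; lia.
  rewrite IH; last by lia.
  move=> /eqP; rewrite subr_eq0 => /eqP e.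
  apply: (mulfI B0); rewrite e !exprS; field.
  by rewrite B0 expf_neq0.
have := G_down m.+1 0%N (leqnn _); rewrite subnn => ->.
have := G_m r.+1 (leqnn _); rewrite subnn => ->.
have := G_m r (leqnSn _); rewrite subSnn => ->.
(* Over a common denominator the two terms produce [b m.+2 ^+ 2 - b m.+1 * b m.+3], which [cassini]
   evaluates. *)
transitivity (s ^+ m.+2 ^+ 2 * (s ^+ 2 * b m.+2) ^+ r / b m.+3 ^+ r.+2).
  have -> : s ^+ m.+2 ^+ 2 = s ^+ 2 * (b m.+2 ^+ 2 - b m.+1 * b m.+3).
    by rewrite cassini [s ^+ m.+2]exprS exprMn.
  rewrite !exprS; field.
  by rewrite B0 expf_neq0.
have um0 : u m.+2 != 0 by move: B0; rewrite bE mulf_eq0 negb_or => /andP[].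
have -> : s ^+ 2 * b m.+2 = s * s ^+ m.+2 * u m.+1.
  by rewrite bE !exprS; ring.
have : s ^+ m.+2 != 0 by rewrite expf_neq0.
rewrite bE; move: (s ^+ m.+2) => A A0; rewrite !exprMn !exprS; field.
by rewrite A0 um0 !expf_neq0.
Qed.

(** * Power series and Chebyshev polynomials *)

Lemma fcoefXM (K : idomainType) (f : fps K) n :
  fcoef (fpsX * f) n = if n is n'.+1 then fcoef f n' else 0.
Proof.
rewrite fcoefM; case: n => [|n]; first by rewrite big_ord1 mul0r.
rewrite big_ord_recl mul0r add0r big_ord_recl mul1r subSS subn0.
by rewrite big1 ?addr0// => i _; rewrite mul0r.
Qed.

Lemma fps_compX2D (K : zmodType) (f g : fps K) :
  fps_compX2 (f + g) = fps_compX2 f + fps_compX2 g.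
Proof. by apply/fpsP => n /=; case: ifP => _ //=; rewrite addr0. Qed.

(** This turns the factor x of the recurrences into the square of s. *)
Lemma fps_compX2XM (K : idomainType) (f : fps K) :
  fps_compX2 (fpsX * f) = fpsX ^+ 2 * fps_compX2 f.
Proof.
have fcoef_compX2 (g : fps K) n :
  fcoef (fps_compX2 g) n = if odd n then 0 else fcoef g n./2 by [].
apply/fpsP => n; rewrite expr2 -mulrA fcoefXM fcoef_compX2 fcoefXM.
case: n => [|[|n]] //; first by rewrite fcoefXM.
by rewrite fcoefXM fcoef_compX2 oddS oddS negbK.
Qed.

Lemma fps_compX2_0 (K : zmodType) : fps_compX2 (0 : fps K) = 0.
Proof. by apply/fpsP => n /=; case: ifP. Qed.

Lemma fps_compX2_1 (K : idomainType) : fps_compX2 (1 : fps K) = 1.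
Proof. by apply/fpsP => -[|[|n]] //=; case: ifP. Qed.

(** * Generating functions of the states *)

Definition continuations_gf (K : idomainType) m r h c : fps K :=
  Fps (fun n => (continuations m r n h c)%:R).

Section ContinuationsGF.
Variables (K : idomainType) (m r : nat).
Hypotheses (m_gt0 : (0 < m)%N) (le_rm : (r <= m)%N).
Local Notation gf := (continuations_gf K m r).

Lemma continuations_gf_gt h c : (r < c)%N -> gf h c = 0.
Proof. by move=> rc; apply/fpsP => n /=; rewrite continuations_gt. Qed.

(** The constant terms agree because the room is irrelevant when no entry remains to be appended. *)
Lemma continuations_gf_below h c : (h.+1 < m)%N ->
  gf h.+1 c = gf h c + fpsX * gf h.+2 c.
Proof.
move=> hm; apply/fpsP => -[|n]; rewrite fcoefD fcoefXM; first by rewrite addr0.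
by rewrite -natrD -continuations_below.
Qed.

Lemma continuations_gf_top c : gf m c = gf m.-1 c + fpsX * gf m c.+1.
Proof.
apply/fpsP => -[|n]; rewrite fcoefD fcoefXM; first by rewrite addr0.
by rewrite -natrD -continuations_top.
Qed.

Lemma continuations_gf_0 c : gf 0%N c = (c == r)%:R + fpsX * gf 1%N c.
Proof.
apply/fpsP => n; rewrite fcoefD fcoefXM.
case: n => [|n] /=; first by rewrite addr0; case: eqP.
by rewrite big_ord0 addn0; case: eqP; rewrite add0r.
Qed.

End ContinuationsGF.

(** * Chebyshev recurrence and values at 1/(2s) *)

Section Chebyshev.
Variables (R : realType) (U : nat -> {poly R}).
Hypothesis U_cheb : forall n : nat, is_chebyshevU n (U n).

Lemma chebyshevU_0 : U 0%N = 1.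
Proof.
apply: (is_chebyshevU_unique (U_cheb 0)) => t t0.
by rewrite hornerC mul1r divff.
Qed.

Lemma chebyshevU_1 : U 1%N = 2%:R *: 'X.
Proof.
apply: (is_chebyshevU_unique (U_cheb 1)) => t t0.
by rewrite hornerZ hornerX !mulr_natl sin_mulr2n mulrnAl mulfK.
Qed.

(** By uniqueness it suffices to compare values at [cos t], where the addition formulas for sine
    give the recurrence. *)
Lemma chebyshevU_S n : U n.+2 = 2%:R *: 'X * U n.+1 - U n.
Proof.
apply: (is_chebyshevU_unique (U_cheb n.+2)) => t t0.
rewrite !hornerE !U_cheb//; apply: (mulIf t0).
rewrite mulrBl mulrA !divfK//.
have -> : n.+3%:R * t = n.+2%:R * t + t by rewrite -natr1 mulrDl mul1r.
have -> : n.+1%:R * t = n.+2%:R * t - t.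
  by rewrite -[n.+2%:R]natr1 mulrDl mul1r addrK.
by rewrite sinB sinD; ring.
Qed.

Variables (L : fieldType) (phi : {rmorphism R -> L}) (s : L).
Hypothesis s_neq0 : s != 0.
Local Notation Us n := (map_poly phi (U n)).[1 / (2 * s)].

Let phi2 : phi 2%:R / (2 * s) = s^-1.
Proof.
have two_neq0 : 2 != 0 :> L by rewrite -(rmorph_nat phi) fmorph_eq0 pnatr_eq0.
by rewrite rmorph_nat; field; rewrite s_neq0 two_neq0.
Qed.

Lemma chebyshevU_eval_0 : Us 0%N = 1.
Proof. by rewrite chebyshevU_0 rmorph1 hornerC. Qed.

Lemma chebyshevU_eval_1 : Us 1%N = s^-1.
Proof. by rewrite chebyshevU_1 map_polyZ map_polyX hornerZ hornerX mul1r phi2. Qed.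

Lemma chebyshevU_eval_S n : Us n.+2 = Us n.+1 / s - Us n.
Proof.
rewrite chebyshevU_S rmorphB rmorphM /= map_polyZ map_polyX hornerD hornerN.
by rewrite hornerM hornerZ hornerX mul1r phi2 mulrC.
Qed.

End Chebyshev.

(* The identity is stated in the field of Laurent series in s = sqrt x. *)
Theorem theorem10 (R : realType) (U : nat -> {poly R})
    (U_cheb : forall n : nat, is_chebyshevU n (U n))
    (k r : nat) (k_ge2 : (2 <= k)%N) (r_bounds : (1 <= r <= k - 1)%N) :
  let s : laurent R := fpsX%:F in
  let Us (n : nat) : laurent R := (map_poly (@laurentC R) (U n)).[1 / (2 * s)] in
  (fps_compX2 (perm_gf R (fun n (p : 'S_n) =>
     avoids pattern123 p && (#|occurrences (decr_max (k - 1)) p| == r))))%:F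
  = s ^+ (r - 1) * (Us (k - 1)%N ^+ (r - 1) / Us k ^+ (r + 1)).
Proof.
move=> s Us.
have s0 : s != 0.
  rewrite tofrac_eq0; apply/eqP => /fpsP/(_ 1%N) /eqP.
  by rewrite fcoef0 oner_eq0.
(* Write [k] as [m + 2] and then [r] as [r + 1]; the exponents become [r] and [r + 2], as in
   [transfer_solution]. *)
case: k k_ge2 r_bounds => [//|[//|m]] _; rewrite subn1 [m.+2.-1]/=.
case: r => [//|r] /andP[_ le_rm]; rewrite subn1 addn1 [r.+1.-1]/=.
have -> : perm_gf R (fun n (p : 'S_n) => avoids pattern123 p
    && (#|occurrences (decr_max m.+1) p| == r.+1))
    = continuations_gf R m.+1 r.+1 0 0.
  by apply/fpsP => n /=; rewrite card_avoids_occurrences.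
pose G h c : laurent R := (fps_compX2 (continuations_gf R m.+1 r.+1 h c))%:F.
have GD f g : (fps_compX2 (f + fpsX * g))%:F
    = (fps_compX2 f)%:F + s ^+ 2 * (fps_compX2 g)%:F :> laurent R.
  by rewrite fps_compX2D fps_compX2XM rmorphD rmorphM rmorphXn.
apply: (@transfer_solution _ s Us G m r) => //.
- exact: chebyshevU_eval_0.
- exact: chebyshevU_eval_1.
- by move=> n; apply: chebyshevU_eval_S.
- by move=> c; rewrite /G {1}continuations_gf_top.
- by move=> h c hm; rewrite /G continuations_gf_below.
- move=> c; rewrite /G continuations_gf_0 GD; congr (_ + _).
  by case: eqP; rewrite ?fps_compX2_0 ?fps_compX2_1 ?rmorph0 ?rmorph1.
- by rewrite /G continuations_gf_gt// fps_compX2_0 rmorph0.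
Qed.
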